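(* Let $(\Omega,\mathcal F,\mathbb P)$ be a nonatomic probability space and $0\le p\le\infty$. Let $\mathcal A\subset L^p$ be an acceptance set and $S=(S_0,S_T)$ a traded asset. Assume $\mathbb P(S_T<S_0)=0$. Then $\rho_{\mathcal A,S}$ is cash subadditive.
   Context: $L^p=L^p(\Omega,\mathcal F,\mathbb P)$ is ordered by the almost sure order with positive cone $L^p_+$. An acceptance set is a nonempty proper subset $\mathcal A\subset L^p$ such that $X\in\mathcal A$ and $Y\ge X$ imply $Y\in\mathcal A$. A traded asset is a pair $S=(S_0,S_T)$ with $S_0>0$ real and $S_T\in L^p_+$ nonzero. The risk measure is $\rho_{\mathcal A,S}(X)=\inf\{m\in\mathbb R : X+\frac{m}{S_0}S_T\in\mathcal A\}\in\mathbb R\cup\{\pm\infty\}$ with $\inf\emptyset=\infty$. A function $\rho:L^p\to\mathbb R\cup\{\pm\infty\}$ is cash subadditive if it is decreasing ($X\le Y$ implies $\rho(X)\ge\rho(Y)$) and $\rho(X+\lambda 1_\Omega)\ge\rho(X)-\lambda$ for all $\lambda>0$ and $X\in L^p$. *)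

(* Defs.v *)
From HB Require Import structures.
From mathcomp Require Import all_boot all_order all_algebra.
From mathcomp Require Import all_classical all_reals all_analysis.
From mathcomp Require Import measurable_realfun.

Set Implicit Arguments.
Unset Strict Implicit.
Unset Printing Implicit Defensive.
Import Order.TTheory GRing.Theory Num.Theory.
Import numFieldNormedType.Exports.

Local Open Scope classical_set_scope.
Local Open Scope ring_scope.

Definition nonatomic d (T : measurableType d) (R : realType)
    (P : probability T R) : Prop :=
  forall E : set T, measurable E -> (0 < P E)%E ->
    exists F : set T, [/\ measurable F, F `<=` E & (0 < P F < P E)%E].

Section L0_space.
Context d (T : measurableType d) (R : realType) (P : probability T R).

Definition L0 : Type := {mfun_ P, T >-> R}.

HB.instance Definition _ := Choice.on L0.
HB.instance Definition _ := EqQuotient.on L0.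

Definition L0_rep (X : L0) : {mfun T >-> R} := repr X.

(* The function [X : T -> R] attached to a class is a representative of it
   (chosen by [repr]); what is said below of such representatives is invariant
   under almost sure equality. *)
Definition L0_fun (X : L0) : T -> R := L0_rep X.
Coercion L0_fun : L0 >-> Funclass.

Definition L0_class (f : {mfun T >-> R}) : L0 :=
  \pi_L0%qT f.

Lemma L0_classK (f : {mfun T >-> R}) : {ae P, forall w, L0_class f w = f w}.
Proof.
have : (repr (L0_class f) : {mfun T >-> R})
    = f %[mod {mfun_ P, T >-> R}]%qT by rewrite reprK.
move=> /eqP; rewrite eqmodE => /asboolP.
by apply: filterS => w /(_ I).
Qed.

Lemma L0P (X Y : L0) : {ae P, forall w, X w = Y w} -> X = Y.
Proof.
move=> XY; rewrite -[X]reprK -[Y]reprK; apply/eqP; rewrite eqmodE.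
by apply/asboolP; apply: filterS XY => w XYw _.
Qed.

Definition L0_add (X Y : L0) : L0 := L0_class (L0_rep X + L0_rep Y).
Definition L0_opp (X : L0) : L0 := L0_class (- L0_rep X).
Definition L0_scale (a : R) (X : L0) : L0 := L0_class (a *: L0_rep X).
Definition L0_cst (c : R) : L0 := L0_class (cst c).

Lemma L0_addE X Y : {ae P, forall w, L0_add X Y w = X w + Y w}.
Proof. exact: L0_classK. Qed.

Lemma L0_oppE X : {ae P, forall w, L0_opp X w = - X w}.
Proof. exact: L0_classK. Qed.

Lemma L0_scaleE a X : {ae P, forall w, L0_scale a X w = a * X w}.
Proof. exact: L0_classK. Qed.

Lemma L0_cstE c : {ae P, forall w, L0_cst c w = c}.
Proof. exact: L0_classK. Qed.

Lemma L0_addA : associative L0_add.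
Proof.
move=> X Y Z; apply: L0P.
apply: filterS (filterI (L0_addE X (L0_add Y Z))
  (filterI (L0_addE Y Z)
  (filterI (L0_addE (L0_add X Y) Z)
  (L0_addE X Y)))) => w /= [-> [-> [-> ->]]].
exact: addrA.
Qed.

Lemma L0_addC : commutative L0_add.
Proof.
move=> X Y; apply: L0P.
by apply: filterS (filterI (L0_addE X Y)
  (L0_addE Y X)) => w /= [-> ->]; exact: addrC.
Qed.

Lemma L0_add0 : left_id (L0_cst 0) L0_add.
Proof.
move=> X; apply: L0P.
by apply: filterS (filterI (L0_addE (L0_cst 0) X)
  (L0_cstE 0)) => w /= [-> ->]; exact: add0r.
Qed.

Lemma L0_addN : left_inverse (L0_cst 0) L0_opp L0_add.
Proof.
move=> X; apply: L0P.
apply: filterS (filterI (L0_addE (L0_opp X) X)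
  (filterI (L0_oppE X)
  (L0_cstE 0))) => w /= [-> [-> ->]].
exact: addNr.
Qed.

HB.instance Definition _ :=
  GRing.isZmodule.Build L0 L0_addA L0_addC L0_add0 L0_addN.

Lemma L0_scaleA a b X : L0_scale a (L0_scale b X) = L0_scale (a * b) X.
Proof.
apply: L0P; apply: filterS (filterI (L0_scaleE a (L0_scale b X))
  (filterI (L0_scaleE b X)
  (L0_scaleE (a * b) X))) => w /= [-> [-> ->]].
exact: mulrA.
Qed.

Lemma L0_scale1 : left_id 1 L0_scale.
Proof.
move=> X; apply: L0P.
by apply: filterS (L0_scaleE 1 X) => w /= ->; exact: mul1r.
Qed.

Lemma L0_scaleDr : right_distributive L0_scale +%R.
Proof.
move=> a X Y; apply: L0P.
apply: filterS (filterI (L0_scaleE a (X + Y))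
  (filterI (L0_addE X Y)
  (filterI (L0_addE (L0_scale a X) (L0_scale a Y))
  (filterI (L0_scaleE a X)
  (L0_scaleE a Y))))) => w /= [-> [-> [-> [-> ->]]]].
exact: mulrDr.
Qed.

Lemma L0_scaleDl X : {morph L0_scale^~ X : a b / a + b}.
Proof.
move=> a b; apply: L0P.
apply: filterS (filterI (L0_scaleE (a + b) X)
  (filterI (L0_addE (L0_scale a X) (L0_scale b X))
  (filterI (L0_scaleE a X)
  (L0_scaleE b X)))) => w /= [-> [-> [-> ->]]].
exact: mulrDl.
Qed.

HB.instance Definition _ := GRing.Zmodule_isLmodule.Build R L0
  L0_scaleA L0_scale1 L0_scaleDr L0_scaleDl.

Definition as_le (X Y : L0) : Prop := {ae P, forall w, X w <= Y w}.

(* The library's [LspaceType] requires [1 <= p].  Its [Lnorm], hence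
   [finite_norm], makes sense for every [p]: for [0 < p < +oo] finiteness means
   that [|X| ^ p] is integrable, for [p = +oo] that [X] is essentially bounded,
   and for [p = 0] it always holds ([Lp_0] below), as it should. *)
Definition Lp (p : \bar R) : set L0 := [set X | finite_norm P p X].

Lemma Lp_0 : Lp 0%E = setT.
Proof.
apply/seteqP; split=> // X _.
by rewrite /Lp /= /finite_norm unlock /= invr0 poweRe0 ltry.
Qed.

Definition acceptance_set (p : \bar R) (A : set L0) : Prop :=
  [/\ A !=set0, A `<` Lp p &
    forall X Y, A X -> Lp p Y -> as_le X Y -> A Y].

Record traded_asset (p : \bar R) := TradedAsset {
  price : R;
  payoff : L0;
  price_gt0 : 0 < price;
  payoff_Lp : Lp p payoff;
  payoff_ge0 : as_le 0 payoff;
  payoff_neq0 : payoff <> 0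
}.

Definition risk_measure (p : \bar R) (A : set L0) (S : traded_asset p)
    (X : L0) : \bar R :=
  ereal_inf [set m%:E | m in [set m : R | A (X + (m / price S) *: payoff S)]].

Definition cash_subadditive (p : \bar R) (rho : L0 -> \bar R) : Prop :=
  (forall X Y, Lp p X -> Lp p Y -> as_le X Y -> (rho Y <= rho X)%E) /\
  (forall (lambda : R) X, 0 < lambda -> Lp p X ->
     (rho X - lambda%:E <= rho (X + lambda *: L0_cst 1)%R)%E).

End L0_space.

(* Main.v *)
Require Import Defs.
From mathcomp Require Import all_boot all_order all_algebra.
From mathcomp Require Import all_classical all_reals all_analysis.
From mathcomp Require Import measurable_realfun.
From mathcomp Require Import ess_sup_inf.

Set Implicit Arguments.
Unset Strict Implicit.
Unset Printing Implicit Defensive.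
Import Order.TTheory GRing.Theory Num.Theory.
Local Open Scope classical_set_scope.
Local Open Scope ring_scope.

(** Both halves compare sets of admissible [m]. Since [A] is upward closed, a larger position admits
    every [m] that a smaller one admits, so its infimum is lower. For the cash bound,
    [payoff S >= price S] almost surely, so if [m] is admissible for [X + l] then [m + l] is
    admissible for [X]; taking infima gives the claim. Upward closure speaks only of positions in
    [Lp p], so these must be shown to stay there for every [p >= 0]: this is [Lp_addZ], obtained
    from [Lp_max_le]. *)

(** The power of a maximum is one of the two powers, hence at most their sum; no convexity enters,
    so [r < 1] is covered. *)
Lemma powR_max_le (R : realType) (r c x y z : R) :
  0 <= r -> 0 <= c -> 0 <= x -> 0 <= y -> 0 <= z ->
  z <= c * Num.max x y -> z `^ r <= c `^ r * (x `^ r + y `^ r).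
Proof.
move=> r0 c0 x0 y0 z0 zle.
have m0 : 0 <= Num.max x y by rewrite le_max x0.
apply: (@le_trans _ _ ((c * Num.max x y) `^ r)).
  by apply: ge0_ler_powR => //; rewrite nnegrE// mulr_ge0.
rewrite powRM// ler_wpM2l ?powR_ge0//.
by case: (leP x y) => _; [rewrite lerDr | rewrite lerDl]; exact: powR_ge0.
Qed.

Section Lp_stability.
Context d (T : measurableType d) (R : realType) (P : probability T R).
Implicit Types (X Y Z : L0 P) (p : \bar R).

Lemma L0_measurable X : measurable_fun [set: T] X.
Proof. exact: (measurable_funPT (L0_rep X)). Qed.

Lemma L0_powR_measurable (r : R) X :
  measurable_fun [set: T] (fun w => (`|X w| `^ r)%:E).
Proof.
apply/measurable_EFinP.
apply: (measurableT_comp (measurable_powR r)).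
by apply: measurableT_comp => //; exact: L0_measurable.
Qed.

(** Finiteness passes through the outer root of the norm, and the power [r] undoes that root. *)
Lemma Lp_finP (r : R) X : r != 0 ->
  Lp (P := P) r%:E X <-> (\int[P]_w (`|X w| `^ r)%:E < +oo)%E.
Proof.
move=> r0; rewrite /Lp /= /finite_norm; split.
  by move=> /(poweR_lty r); rewrite powR_Lnorm.
by rewrite unlock /= => ?; exact: poweR_lty.
Qed.

Lemma Lp_yP X : Lp (P := P) +oo%E X <->
  exists M : R, {ae P, forall w, `|X w| <= M}.
Proof.
(* The norm at [+oo] is defined by cases on the total mass being positive; mass 1 selects the
   essential supremum. *)
rewrite /Lp /= /finite_norm unlock /= probability_setT lte01; split.
  exact: ess_supr_bounded.
move=> [M XM]; apply: (@le_lt_trans _ _ M%:E); last exact: ltry.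
apply/ess_supP; apply: filterS XM => w /=.
by rewrite lee_fin.
Qed.

(* Minkowski's inequality fails for [p < 1]; comparing with the maximum works
   for all [p] at once. *)
Lemma Lp_max_le p (c : R) X Y Z : (0 <= p)%E -> 0 <= c ->
  {ae P, forall w, `|Z w| <= c * Num.max `|X w| `|Y w|} ->
  Lp p X -> Lp p Y -> Lp p Z.
Proof.
case: p => [r| |] //; last first.
  move=> _ c0 ZXY /Lp_yP[M XM] /Lp_yP[N YN].
  apply/Lp_yP; exists (c * Num.max M N).
  apply: filterS (filterI ZXY (filterI XM YN)) => w /= [Zw [Xw Yw]].
  rewrite (le_trans Zw)// ler_wpM2l// ge_max !le_max Xw Yw.
  by rewrite orbT.
rewrite lee_fin => r0 c0 ZXY.
have [->|rN0] := eqVneq r 0; first by rewrite Lp_0.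
move=> /(Lp_finP _ rN0) intX /(Lp_finP _ rN0) intY; apply/(Lp_finP _ rN0).
have pos (U : L0 P) w : [set: T] w -> (0 <= (`|U w| `^ r)%:E)%E.
  by move=> _; rewrite lee_fin powR_ge0.
have posD w : [set: T] w -> (0 <= (`|X w| `^ r)%:E + (`|Y w| `^ r)%:E)%E.
  by move=> ?; rewrite adde_ge0// pos.
have mD : measurable_fun [set: T]
    (fun w => (`|X w| `^ r)%:E + (`|Y w| `^ r)%:E)%E.
  by apply: emeasurable_funD; exact: L0_powR_measurable.
apply: (@le_lt_trans _ _ (\int[P]_w
    ((c `^ r)%:E * ((`|X w| `^ r)%:E + (`|Y w| `^ r)%:E)))%E).
  apply: ae_ge0_le_integral => //.
  - exact: L0_powR_measurable.
  - by move=> w ?; rewrite mule_ge0 ?lee_fin ?powR_ge0// posD.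
  - exact: measurable_funeM.
  - apply: filterS ZXY => w /= Zw _.
    by rewrite -EFinD -EFinM lee_fin powR_max_le.
rewrite ge0_integralZl_EFin ?powR_ge0// ge0_integralD//;
  try exact: pos; try exact: L0_powR_measurable.
by rewrite lte_mul_pinfty ?lee_fin ?powR_ge0// lte_add_pinfty.
Qed.

Lemma Lp_addZ p (a : R) X Y : (0 <= p)%E ->
  Lp p X -> Lp p Y -> Lp p (X + a *: Y).
Proof.
(* The constant comes from bounding both terms of [|X| + |a| * |Y|] by the maximum of [|X|] and
   [|Y|]. *)
move=> p0; apply: (@Lp_max_le _ (1 + `|a|)) => //.
apply: filterS (filterI (L0_addE X (a *: Y)) (L0_scaleE a Y)) => w /= [-> ->].
rewrite (le_trans (ler_normD _ _))// normrM mulrDl mul1r.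
by rewrite lerD ?ler_wpM2l// le_max lexx ?orbT.
Qed.

End Lp_stability.

Theorem proposition5p1 (d : measure_display) (T : measurableType d)
    (R : realType) (P : probability T R) (hP : nonatomic P)
    (p : \bar R) (hp : (0 <= p)%E)
    (A : set (L0 P)) (hA : acceptance_set p A) (S : traded_asset P p)
    (hS : P [set w | payoff S w < price S] = 0%E) :
  cash_subadditive p (risk_measure A S).
Proof.
case: hA => _ _ A_up.
have S_Lp := payoff_Lp S; have S0_gt0 := price_gt0 S.
split=> [X Y X_Lp Y_Lp XY|l X l0 X_Lp].
  apply: le_ereal_inf => _ [m /= Am <-]; exists m => //=.
  apply: A_up Am _ _; first exact: Lp_addZ.
  apply: filterS (filterI XY (filterI
    (L0_addE X ((m / price S) *: payoff S))
    (L0_addE Y ((m / price S) *: payoff S)))) => w /= [XYw [-> ->]].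
  by rewrite lerD2r.
have S_ge : {ae P, forall w, price S <= payoff S w}.
  (* The event in [hS] is its own null cover, once shown measurable as the preimage of [true] under
     a comparison. *)
  exists [set w | payoff S w < price S]; split => //.
    rewrite -[X in measurable X]setTI.
    apply: (measurable_fun_ltr (L0_measurable _) (measurable_cst _)
      measurableT (Y := [set true])) => //.
  by move=> w /= /negP; rewrite -ltNge.
apply: le_ereal_inf_tmp => _ [m Am <-].
(* Moving [l] across is safe even if the risk is infinite, because [l] is real. *)
rewrite leeBlDr// -EFinD; apply: ereal_inf_lbound.
(* As [payoff S >= price S] a.s., [l / price S] units of the asset dominate the
   cash amount [l]. *)
exists (m + l) => //; apply: A_up Am _ _; first exact: Lp_addZ.
apply: filterS (filterI S_ge
  (filterI (L0_addE X (((m + l) / price S) *: payoff S))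
  (filterI (L0_scaleE ((m + l) / price S) (payoff S))
  (filterI (L0_addE (X + l *: L0_cst P 1) ((m / price S) *: payoff S))
  (filterI (L0_addE X (l *: L0_cst P 1))
  (filterI (L0_scaleE l (L0_cst P 1))
  (filterI (L0_cstE P 1)
  (L0_scaleE (m / price S) (payoff S))))))))) => w /=.
move=> [Sw [-> [-> [-> [-> [-> [-> ->]]]]]]].
(* Cancelling [X] and the [m / price S] units leaves [l <= l / price S * payoff S w], which follows
   from [Sw]. *)
rewrite -addrA lerD2l mulr1 (mulrDl m) (mulrDl (m / _)) addrC lerD2l.
by rewrite -mulrA ler_peMr ?(ltW l0)// ler_pdivlMl// mulr1.
Qed.
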